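(* Let $\mathcal{A}$ be a unital sub-algebra of $C(I,\mathbb{R})$ which separates points of $I=[0,1]$. For every $m\in\mathbb{Z}$ and $q\in S^1$, the set $P_{m,q}^{\mathcal{A}}(S^1,S^1)$ is dense in $C_m^q(S^1,S^1)$ with respect to the metric $d_0$.
   Context: $S^1=\{(x,y)\in\mathbb{R}^2: x^2+y^2=1\}$, $I=[0,1]$, $C(S^1,S^1)$ is the set of all continuous functions from $S^1$ to $S^1$, and $C(I,\mathbb{R})$ is the real algebra of continuous functions $I\to\mathbb{R}$ (pointwise operations). A sub-algebra is unital if it contains the constant function $1$; it separates points if for all $s\ne t$ in $I$ it contains some $h$ with $h(s)\neq h(t)$. Let $\alpha:[0,1]\to S^1$, $\alpha(t)=(\cos 2\pi t,\sin 2\pi t)$, and let $p:\mathbb{R}\to S^1$, $p(t)=(\cos 2\pi t,\sin 2\pi t)$, be the covering map. For $f\in C(S^1,S^1)$, let $\tilde{f_\alpha}:I\to\mathbb{R}$ be the unique continuous map with $p\circ\tilde{f_\alpha}=f\circ\alpha$ and $\tilde{f_\alpha}(0)\in[0,1)$. For $x\in S^1$, $x\neq(1,0)$, $\alpha^{-1}(x)$ denotes the unique $t\in(0,1)$ with $\alpha(t)=x$. The metric $d_0$ on $C(S^1,S^1)$ is $$d_0(f,g)=2\pi\sup_{x\in S^1,\ x\neq(1,0)}\left|\tilde{f_\alpha}(\alpha^{-1}(x))-\tilde{g_\alpha}(\alpha^{-1}(x))\right|.$$ The winding number of $f\in C(S^1,S^1)$ is the integer $W(f)=\tilde{f_\alpha}(1)-\tilde{f_\alpha}(0)$.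 For $a,b\in\mathbb{R}$, $\mathcal{A}_{0,1}^{a,b}(I,\mathbb{R})=\{h\in\mathcal{A}: h(0)=a,\ h(1)=b\}$. For $q\in S^1$, let $\tilde q$ be the unique element of $[0,1)$ with $p(\tilde q)=q$. For $q\in S^1$ and $m\in\mathbb{Z}$, $$C_m^q(S^1,S^1)=\{f\in C(S^1,S^1): f((1,0))=q,\ W(f)=m\},$$ $$P_{m,q}^{\mathcal{A}}(S^1,S^1)=\{f\in C(S^1,S^1): \tilde{f_\alpha}\in \mathcal{A}_{0,1}^{\tilde q,\tilde q+m}(I,\mathbb{R}),\ p\circ\tilde{f_\alpha}(0)=q\}.$$ *)

(* Defs.v *)
From HB Require Import structures.
From mathcomp Require Import all_boot all_order all_algebra.
From mathcomp Require Import all_classical all_reals all_analysis.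

Set Implicit Arguments.
Unset Strict Implicit.
Unset Printing Implicit Defensive.

Import Order.TTheory GRing.Theory Num.Theory.
Import numFieldNormedType.Exports.

Local Open Scope classical_set_scope.
Local Open Scope ring_scope.

(* [circle R] and [unitI R] are sets; used as types they are the corresponding
   [set_type], which carries the subspace topology. *)
Definition circle (R : realType) : set (R * R) :=
  [set z | z.1 ^+ 2 + z.2 ^+ 2 = 1].

Definition unitI (R : realType) : set R := `[0, 1].

Arguments circle R : clear implicits.
Arguments unitI R : clear implicits.

Lemma unitI_0 (R : realType) : (0 : R) \in unitI R.
Proof. by apply/mem_set; rewrite /unitI /= in_itv /= lexx ler01. Qed.

Lemma unitI_1 (R : realType) : (1 : R) \in unitI R.
Proof. by apply/mem_set; rewrite /unitI /= in_itv /= lexx ler01. Qed.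

Definition I0 (R : realType) : unitI R := exist _ 0 (unitI_0 R).
Definition I1 (R : realType) : unitI R := exist _ 1 (unitI_1 R).

Lemma circle_cos_sin (R : realType) (t : R) :
  (cos (2 * pi * t), sin (2 * pi * t)) \in circle R.
Proof. by apply/mem_set; rewrite /circle /= cos2Dsin2. Qed.

Definition covering_map (R : realType) (t : R) : circle R :=
  exist _ (cos (2 * pi * t), sin (2 * pi * t)) (circle_cos_sin t).

Definition alpha (R : realType) (t : unitI R) : circle R := covering_map (set_val t).

Lemma circle_10 (R : realType) : ((1 : R), (0 : R)) \in circle R.
Proof. by apply/mem_set; rewrite /circle /= expr1n expr0n addr0. Qed.

Definition base_pt (R : realType) : circle R := exist _ (1, 0) (circle_10 R).

(* [xget] picks an element of a set; each of the three sets below is a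
   singleton (for [alpha_inv], when [x <> base_pt R]), so the default value
   is never used. *)
Definition alpha_inv (R : realType) (x : circle R) : unitI R :=
  xget (I0 R) [set t | 0 < set_val t < 1 /\ alpha t = x].

Definition lift_alpha (R : realType) (f : continuousType (circle R) (circle R))
    : unitI R -> R :=
  xget (cst 0) [set h : unitI R -> R |
    [/\ continuous h,
        forall t, covering_map (h t) = f (alpha t)
      & 0 <= h (I0 R) < 1]].

Definition angle (R : realType) (q : circle R) : R :=
  xget 0 [set t : R | 0 <= t < 1 /\ covering_map t = q].

Definition d0 (R : realType) (f g : continuousType (circle R) (circle R)) : R :=
  2 * pi * sup [set `|lift_alpha f (alpha_inv x) - lift_alpha g (alpha_inv x)|
               | x in [set x : circle R | x <> base_pt R]].

(* An integer, viewed in R. *)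
Definition winding (R : realType) (f : continuousType (circle R) (circle R))
    : R :=
  lift_alpha f (I1 R) - lift_alpha f (I0 R).

Definition unital_subalgebra (R : realType) (A : set (unitI R -> R)) : Prop :=
  [/\ forall h, A h -> continuous h,
      A (fun=> 1),
      forall g h, A g -> A h -> A (fun t => g t + h t),
      forall g h, A g -> A h -> A (fun t => g t * h t)
    & forall (k : R) h, A h -> A (fun t => k * h t)].

Definition separates_points (R : realType) (A : set (unitI R -> R)) : Prop :=
  forall s t : unitI R, s <> t -> exists2 h, A h & h s <> h t.

Definition endpoint_subset (R : realType) (A : set (unitI R -> R)) (a b : R)
    : set (unitI R -> R) :=
  [set h | [/\ A h, h (I0 R) = a & h (I1 R) = b]].

Definition C_mq (R : realType) (m : int) (q : circle R)
    : set (continuousType (circle R) (circle R)) :=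
  [set f : continuousType (circle R) (circle R) |
    f (base_pt R) = q /\ winding f = m%:~R].

Definition P_mq (R : realType) (A : set (unitI R -> R)) (m : int)
    (q : circle R) : set (continuousType (circle R) (circle R)) :=
  [set f : continuousType (circle R) (circle R) |
    endpoint_subset A (angle q) (angle q + m%:~R) (lift_alpha f)
           /\ covering_map (lift_alpha f (I0 R)) = q].

Definition dense_in (R : realType) (T : Type) (d : T -> T -> R)
    (P C : set T) : Prop :=
  P `<=` C /\
  forall f, C f -> forall e : R, 0 < e -> exists2 g, P g & d f g < e.

(* Main.v *)
(* A map f in C_mq is determined by its lift, a continuous function on [0, 1]
   with endpoint values angle q and angle q + m. By Stone-Weierstrass, A
   contains functions uniformly close to the lift, and adding a combination
   of 1 - w and w, where w in A has w 0 = 0 and w 1 = 1, corrects the endpoint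
   values at the cost of a bounded factor in the error. The corrected function
   h has h 1 - h 0 an integer, so its projection to the circle factors through
   the quotient map alpha and yields a circle map; by uniqueness of lifts h is
   the lift of that map, and d0 is controlled by the uniform distance. *)

From HB Require Import structures.
Require Import Defs.
From mathcomp Require Import all_boot all_order all_algebra.
From mathcomp Require Import all_classical all_reals all_analysis.
From mathcomp Require Import ring lra zify.

Set Implicit Arguments.
Unset Strict Implicit.
Unset Printing Implicit Defensive.

Import Order.TTheory GRing.Theory Num.Theory.
Import numFieldNormedType.Exports.

Local Open Scope classical_set_scope.
Local Open Scope ring_scope.

(** * The Stone-Weierstrass theorem *)

(* Compactness as an induction principle. If [setT] is not in the ideal [D],
   the complements of the members of [D] form a proper filter, and a cluster
   point of it has no neighbourhood in [D]. *)
Lemma compact_ideal (T : topologicalType) (D : set (set T)) :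
  compact [set: T] -> D set0 ->
  (forall U V, D U -> D V -> D (U `|` V)) ->
  (forall U V, U `<=` V -> D V -> D U) ->
  (forall x : T, exists2 U, nbhs x U & D U) -> D [set: T].
Proof.
move=> cT D0 DU DS Dx; apply: contrapT => nDT.
pose F : set_system T := [set U | D (~` U)].
have FF : ProperFilter F.
  split; first by rewrite /F/= setC0.
  split; rewrite /F /=.
  - by rewrite setCT.
  - by move=> P Q /= DP DQ; rewrite setCI; exact: DU.
  - by move=> P Q PQ /=; apply: DS; exact: subsetC.
have FT : F setT by rewrite /F /= setCT.
have [x [_ clx]] := cT F FF FT.
have [U xU DUx] := Dx x.
have FU : F (~` U) by rewrite /F/= setCK.
by have [y [nUy Uy]] := clx _ _ FU xU; exact: nUy.
Qed.

Section stone_weierstrass.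
Context {R : realType} {T : topologicalType}.
Hypothesis cT : compact [set: T].
Variable A : set (T -> R).
Hypothesis Acont : forall h, A h -> continuous h.
Hypothesis A1 : A (fun=> 1).
Hypothesis AD : forall g h, A g -> A h -> A (fun t => g t + h t).
Hypothesis AM : forall g h, A g -> A h -> A (fun t => g t * h t).
Hypothesis AZ : forall (k : R) h, A h -> A (fun t => k * h t).

Lemma continuous_compact_bounded (f : T -> R) :
  continuous f -> exists2 M : R, 0 < M & forall t, `|f t| <= M.
Proof.
move=> cf.
have : compact (f @` setT).
  by apply: continuous_compact cT; exact: continuous_subspaceT.
move=> /compact_bounded [M [_ MP]].
exists (`|M| + 1); first by rewrite ltr_pwDr.
move=> t; apply: (MP (`|M| + 1)); last by exists t.
by rewrite (le_lt_trans (ler_norm _))// ltrDl.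
Qed.

(* Newton-like iteration for the equation p ^ 2 = x ^ 2; on [-1, 1] it
   increases to |x| at rate O(1 / n). *)
Fixpoint abs_approx (x : R) (n : nat) : R :=
  if n is n'.+1 then
    abs_approx x n' + 2^-1 * (x * x + (-1) * (abs_approx x n' * abs_approx x n'))
  else 0.

(** The iteration sees only [x * x], so [x] may be replaced by a = |x|. One step multiplies the
    error d = a - p by 1 - (a + p) / 2 <= 1 - d / 2, and this recursion forces decay like 2 / (n +
    2). *)
Lemma abs_approxP (x : R) (n : nat) : `|x| <= 1 ->
  [/\ 0 <= abs_approx x n, abs_approx x n <= `|x| &
     (`|x| - abs_approx x n) * n.+2%:R <= 2].
Proof.
move=> x1.
have -> : abs_approx x n = abs_approx `|x| n.
  have xx : `|x| * `|x| = x * x by rewrite -expr2 real_normK ?num_real.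
  by elim: n => //= n ->; rewrite xx.
move: `|x| (normr_ge0 x) x1 => a a0 a1.
elim: n => /= [|n [IH0 IHa IH]]; first by split; lra.
set p := abs_approx a n in IH0 IHa IH *.
split; [nra|nra|].
have -> : a - (p + 2^-1 * (a * a + -1 * (p * p))) = (a - p) * (1 - (a + p) / 2).
  by field.
rewrite -[in leLHS](addn1 n.+2) natrD; move: IH; set N := n.+2%:R => IH.
have N2 : 2 <= N by rewrite /N ler_nat.
have [d [d0 da dE]] : exists d, [/\ 0 <= d, d <= a & d = a - p].
  by exists (a - p); split; lra.
rewrite -dE in IH *.
have -> : (a + p) / 2 = a - d / 2 by rewrite dE; field.
apply: (@le_trans _ _ (d * (1 - d / 2) * (N + 1))).
  apply: ler_wpM2r; first lra.
  apply: ler_wpM2l; lra.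
(* The slack 2 - d (1 - d / 2) (N + 1) equals this product plus half of the next one. *)
have h1 : 0 <= (2 - d * N) * (1 - d) by apply: mulr_ge0; lra.
have h2 : 0 <= d * (2 - d * N + d) by apply: mulr_ge0; lra.
lra.
Qed.

Lemma abs_approx_closed f n : A f -> A (fun t => abs_approx (f t) n).
Proof.
move=> Af; elim: n => [|n IH] /=.
  by have := AZ 0 A1; congr (A _); apply/funext => t; rewrite mul0r.
by apply: AD => //; apply: AZ; apply: AD; [exact: AM|apply: AZ; exact: AM].
Qed.

Definition uniform_closure (B : set (T -> R)) : set (T -> R) :=
  [set f | forall e : R, 0 < e -> exists2 g, B g & forall t, `|f t - g t| < e].

Local Notation cl := (uniform_closure A).

Lemma uniform_closure_sub f : A f -> cl f.
Proof. by move=> Af e e0; exists f => // t; rewrite subrr normr0. Qed.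

Lemma uniform_closure_idem f : uniform_closure cl f -> cl f.
Proof.
move=> clf e e0; have e2 : 0 < e / 2 by rewrite divr_gt0.
have [g clg fg] := clf _ e2; have [h Ah gh] := clg _ e2.
exists h => // t; rewrite -(subrKA (g t)) (le_lt_trans (ler_normD _ _))//.
by rewrite (splitr e) ltrD.
Qed.

Lemma uniform_closure_continuous f : cl f -> continuous f.
Proof.
move=> clf t; apply/cvgrPdist_lt => e e0.
have e3 : 0 < e / 3 by rewrite divr_gt0.
have [g Ag fg] := clf _ e3.
have cg : continuous g by exact: Acont.
have /cvgrPdist_lt /(_ _ e3) := cg t.
apply: filterS => u gtu.
have := fg t; have := fg u; move: gtu; rewrite !ltr_norml; lra.
Qed.

Lemma uniform_closureD f g : cl f -> cl g -> cl (fun t => f t + g t).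
Proof.
move=> clf clg e e0; have e2 : 0 < e / 2 by rewrite divr_gt0.
have [f' Af ff] := clf _ e2; have [g' Ag gg] := clg _ e2.
exists (fun t => f' t + g' t); first exact: AD.
by move=> t; have := ff t; have := gg t; rewrite !ltr_norml; lra.
Qed.

Lemma uniform_closureZ k f : cl f -> cl (fun t => k * f t).
Proof.
move=> clf e e0.
have k1 : 0 < `|k| + 1 by rewrite ltr_pwDr.
have [g Ag fg] := clf _ (divr_gt0 e0 k1).
exists (fun t => k * g t); first exact: AZ.
move=> t; rewrite -mulrBr normrM; have := fg t; rewrite ltr_pdivlMr// => h.
apply: le_lt_trans h; rewrite mulrC; apply: ler_wpM2l => //; lra.
Qed.

(** Up to a uniform error [f] may be taken in [A]. A bound [M] then rescales it into [-1, 1], where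
    [abs_approx] converges uniformly without leaving [A]. *)
Lemma uniform_closure_abs f : cl f -> cl (fun t => `|f t|).
Proof.
move=> clf; apply: uniform_closure_idem => e e0.
have [g Ag fg] := clf _ e0.
exists (fun t => `|g t|); last first.
  by move=> t; apply: le_lt_trans (fg t); exact: ler_dist_dist.
have [M M0 gM] := continuous_compact_bounded (Acont Ag).
move=> {f clf fg e0} {}e e0.
(* The error is at most 2 M / (n + 2), which is below [e] once [n] exceeds 2 M / e. *)
pose n := Num.bound (2 * M / e).
exists (fun t => M * abs_approx (M^-1 * g t) n).
  by apply: AZ; apply: (abs_approx_closed (f := fun t => M^-1 * g t)); exact: AZ.
move=> t; set x := M^-1 * g t.
have x1 : `|x| <= 1.
  by rewrite normrM normfV (gtr0_norm M0) mulrC ler_pdivrMr// mul1r.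
have [p0 px pn] := abs_approxP n x1.
have -> : `|g t| = M * `|x|.
  by rewrite -{1}(gtr0_norm M0) -normrM /x mulrA mulfV ?mul1r// gt_eqF.
rewrite -mulrBr ger0_norm; last by apply: mulr_ge0; lra.
have hn : 2 * M / e < n%:R by rewrite /n archi_boundP// divr_ge0// ?mulr_ge0// ltW.
have n2 : (n%:R : R) < n.+2%:R by rewrite ltr_nat ltnS leqnSn.
have n0 : (0 : R) <= n%:R by [].
move: hn; rewrite ltr_pdivrMr// => hn.
have N0 : (0 : R) < n.+2%:R by [].
rewrite -(ltr_pM2r N0) -mulrA.
apply: (@le_lt_trans _ _ (M * 2)); first by apply: ler_wpM2l => //; exact: ltW.
apply: (@lt_le_trans _ _ (n%:R * e)); first by rewrite mulrC.
by rewrite mulrC; apply: ler_wpM2l; exact: ltW.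
Qed.

(** The maximum is (f + g + |f - g|) / 2; the minimum has the opposite sign before the absolute
    value. *)
Lemma uniform_closure_max f g : cl f -> cl g -> cl (fun t => Num.max (f t) (g t)).
Proof.
move=> clf clg.
have clN : cl (fun t => f t + (-1) * g t).
  by apply: uniform_closureD => //; exact: uniform_closureZ.
have := uniform_closureZ 2^-1
  (uniform_closureD (uniform_closureD clf clg) (uniform_closure_abs clN)).
by congr (cl _); apply/funext => t; rewrite maxr_absE mulN1r mulrC.
Qed.

Lemma uniform_closure_min f g : cl f -> cl g -> cl (fun t => Num.min (f t) (g t)).
Proof.
move=> clf clg.
have clN : cl (fun t => f t + (-1) * g t).
  by apply: uniform_closureD => //; exact: uniform_closureZ.
have := uniform_closureZ 2^-1 (uniform_closureD (uniform_closureD clf clg)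
  (uniform_closureZ (-1) (uniform_closure_abs clN))).
by congr (cl _); apply/funext => t; rewrite minr_absE !mulN1r mulrC.
Qed.

Lemma algebra_cst k : A (fun=> k).
Proof. by have := AZ k A1; congr (A _); apply/funext => t; rewrite mulr1. Qed.

Hypothesis Asep : forall s t : T, s <> t -> exists2 h, A h & h s <> h t.

(** An affine rescaling of a function that separates [s] and [t]. The hypothesis admits [s = t], so
    that interpolating [F] at two points needs no case distinction. *)
Lemma algebra_interpolation (s t : T) (a b : R) : (s = t -> a = b) ->
  exists2 h, A h & h s = a /\ h t = b.
Proof.
move=> ab; have [st|st] := pselect (s = t).
  by exists (fun=> a); [exact: algebra_cst|split => //; exact: ab].
have [h Ah hst] := Asep st.
have d0 : h t - h s != 0 by rewrite subr_eq0; apply/eqP => /esym.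
exists (fun u => a + (b - a) / (h t - h s) * (h u + - h s)).
  apply: AD; first exact: algebra_cst.
  by apply: AZ; apply: AD => //; exact: algebra_cst.
by split; field.
Qed.

(** Two-point interpolants of [F] are combined by maxima and then by minima, finitely many at a time
    by compactness. These operations stay in the closure of [A] rather than in [A], hence the
    initial use of idempotence. *)
Lemma stone_weierstrass (F : T -> R) : continuous F -> cl F.
Proof.
move=> cF; apply: uniform_closure_idem => e e0.
(* For fixed [s], the ideal consists of the sets on which some [g] exceeds F - e while staying below
   F + e at [s]; maxima handle unions. *)
have below s : exists2 g, cl g & g s < F s + e /\ forall t, F t - e < g t.
  have [g clg [gs gF]] : exists2 g, cl g &
      g s < F s + e /\ forall t, setT t -> F t - e < g t.
    apply: (@compact_ideal _ (fun U => exists2 g, cl g &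
      g s < F s + e /\ forall t, U t -> F t - e < g t)) => //.
    - exists (fun=> F s); first exact/uniform_closure_sub/algebra_cst.
      by split => //; rewrite ltrDl.
    - move=> U V [g clg [gs gF]] [h clh [hs hF]].
      exists (fun t => Num.max (g t) (h t)); first exact: uniform_closure_max.
      split; first by rewrite gt_max gs.
      by move=> t [/gF|/hF]; rewrite lt_max => ->; rewrite ?orbT.
    - move=> U V UV [g clg [gs gF]]; exists g => //; split => // t /UV; exact: gF.
    - move=> t; have [h Ah [hs ht]] := @algebra_interpolation s t (F s) (F t)
        (fun st => congr1 F st).
      exists [set u | F u - e < h u]; last first.
        exists h; first exact: uniform_closure_sub.
        by split => //; rewrite hs ltrDl.
      have e2 : 0 < e / 2 by rewrite divr_gt0.
      have ch : continuous h by exact: Acont.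
      have /cvgrPdist_lt /(_ _ e2) hct := ch t.
      have /cvgrPdist_lt /(_ _ e2) Fct := cF t.
      near=> u => /=.
      have : `|F t - F u| < e / 2 by near: u.
      have : `|h t - h u| < e / 2 by near: u.
      rewrite ht !ltr_norml; lra.
  by exists g => //; split => // t; exact: gF.
(* Now the lower bound is kept everywhere and the ideal asks for the upper bound; minima handle
   unions. *)
have [g clg [gF Fg]] : exists2 g, cl g &
      (forall t, F t - e < g t) /\ forall t, setT t -> g t < F t + e.
  apply: (@compact_ideal _ (fun U => exists2 g, cl g &
      (forall t, F t - e < g t) /\ forall t, U t -> g t < F t + e)) => //.
  - have [M _ FM] := continuous_compact_bounded cF.
    exists (fun=> M); first exact/uniform_closure_sub/algebra_cst.
    by split => // t; have := FM t; rewrite ler_norml; lra.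
  - move=> U V [g clg [gs gF]] [h clh [hs hF]].
    exists (fun t => Num.min (g t) (h t)); first exact: uniform_closure_min.
    split; first by move=> t; rewrite lt_min gs hs.
    by move=> t [/gF|/hF]; rewrite gt_min => ->; rewrite ?orbT.
  - move=> U V UV [g clg [gs gF]]; exists g => //; split => // t /UV; exact: gF.
  - move=> s; have [g clg [gs gF]] := below s.
    exists [set u | g u < F u + e]; last by exists g.
    (* Half of the gap at [s] is allotted to the variation of [g], half to that of [F]. *)
    have d0 : 0 < (F s + e - g s) / 2 by rewrite divr_gt0// subr_gt0.
    have cg : continuous g by exact: uniform_closure_continuous.
    have /cvgrPdist_lt /(_ _ d0) gct := cg s.
    have /cvgrPdist_lt /(_ _ d0) Fct := cF s.
    near=> u => /=.
    have : `|F s - F u| < (F s + e - g s) / 2 by near: u.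
    have : `|g s - g u| < (F s + e - g s) / 2 by near: u.
    rewrite !ltr_norml; lra.
exists g => // t; have := gF t; have := Fg t I; rewrite ltr_norml; lra.
Unshelve. all: by end_near. Qed.

Lemma stone_weierstrass_endpoints (F : T -> R) (s t : T) (e : R) :
  continuous F -> s <> t -> 0 < e ->
  exists2 h, A h & [/\ h s = F s, h t = F t & forall u, `|F u - h u| < e].
Proof.
move=> cF st e0.
have [w Aw [ws wt]] : exists2 w, A w & w s = 0 /\ w t = 1 :> R.
  exact: algebra_interpolation.
have [M M0 wM] := continuous_compact_bounded (Acont Aw).
(* If [g] has error d, correcting its two values costs at most d (1 + M) + d M, for a total of (2 M
   + 2) d. *)
have K0 : 0 < 2 * M + 2 by lra.
have [g Ag Fg] := stone_weierstrass cF (divr_gt0 e0 K0).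
exists (fun u => g u + ((F s - g s) * (1 + (-1) * w u) + (F t - g t) * w u)).
  apply: AD => //; apply: AD; apply: AZ => //.
  by apply: AD; [exact: algebra_cst|exact: AZ].
split; [by rewrite ws; ring|by rewrite wt; ring|move=> u].
set d := e / _ in Fg.
have -> : e = d + (d * (1 + M) + d * M) by rewrite /d; field; rewrite gt_eqF.
have Fd v : `|F v - g v| <= d by exact/ltW/Fg.
have w1 : `|1 + -1 * w u| <= 1 + M.
  by rewrite mulN1r (le_trans (ler_normB _ _))// normr1 lerD.
rewrite opprD addrA (le_lt_trans (ler_normB _ _))// ltr_leD ?Fg//.
by rewrite (le_trans (ler_normD _ _))// !normrM lerD// ler_pM.
Qed.

End stone_weierstrass.

(** * Uniform continuity and the unit interval *)

(** The sets whose points share one modulus [d] form an ideal. Near [x], half of a radius that suits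
    [e / 2] at [x] serves, by the triangle inequality. *)
Lemma compact_uniformly_continuous (R : realType) (T V : pseudoMetricType R)
    (f : T -> V) : compact [set: T] -> continuous f ->
  forall e : R, 0 < e ->
  exists2 d : R, 0 < d & forall x y, ball x d y -> ball (f x) e (f y).
Proof.
move=> cT cf e e0.
suff [d d0 fd] : exists2 d : R, 0 < d &
    forall x, setT x -> forall y, ball x d y -> ball (f x) e (f y).
  by exists d => // x y; exact: fd.
apply: (@compact_ideal _ (fun U => exists2 d : R, 0 < d &
  forall x, U x -> forall y, ball x d y -> ball (f x) e (f y))) => //.
- by exists 1.
- move=> U V' [d d0 Ud] [d' d'0 Vd]; exists (Num.min d d').
    by rewrite lt_min d0.
  move=> x [Ux|Vx] y xy.
    by apply: Ud => //; apply: le_ball xy; rewrite ge_min lexx.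
  by apply: Vd => //; apply: le_ball xy; rewrite ge_min lexx orbT.
- by move=> U V' UV [d d0 Vd]; exists d => // x /UV; exact: Vd.
- move=> x; have e2 : 0 < e / 2 by rewrite divr_gt0.
  have /nbhs_ballP[r /= r0 rf] : nbhs x (f @^-1` ball (f x) (e / 2)).
    by apply: cf; exact: nbhsx_ballx.
  have r2 : 0 < r / 2 by rewrite divr_gt0.
  exists (ball x (r / 2)); first exact: nbhsx_ballx.
  exists (r / 2) => // y xy z yz; apply: (@ball_splitr _ _ (f x)).
    by apply: rf; apply: le_ball xy; lra.
  by apply: rf; exact: ball_split xy yz.
Qed.

Section unit_interval.
Context {R : realType}.
Implicit Types t : R.

Lemma clamp_subproof t : Num.max 0 (Num.min t 1) \in unitI R.
Proof.
apply/mem_set; rewrite /unitI /= in_itv /= le_max lexx /= ge_max ler01 /=.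
by rewrite ge_min lexx orbT.
Qed.

(** A retraction of the line onto the interval: it turns any real into a point of the subtype and
    extends functions on the interval to the line. *)
Definition clamp t : unitI R :=
  exist (fun x => x \in unitI R) _ (clamp_subproof t).

Lemma clampK : cancel (set_val : unitI R -> R) clamp.
Proof.
move=> [t ht]; apply: eq_sig_hprop => //=.
have := set_mem ht; rewrite /unitI /= in_itv /= => /andP[t0 t1].
by rewrite set_valE /= (min_l t1) (max_r t0).
Qed.

Lemma set_valI01 (t : unitI R) : 0 <= set_val t <= 1.
Proof. by case: t => t ht; have := set_mem ht; rewrite /unitI /= in_itv. Qed.

Lemma clamp0 : clamp 0 = I0 R.
Proof. by rewrite -[RHS]clampK. Qed.

Lemma clamp1 : clamp 1 = I1 R.
Proof. by rewrite -[RHS]clampK. Qed.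

Lemma clamp_lipschitz s t :
  `|set_val (clamp s) - set_val (clamp t)| <= `|s - t|.
Proof.
have h1 := ler_norm (s - t); have h2 := ler_norm (t - s).
rewrite distrC in h2; rewrite !set_valE /= ler_norml.
by case: (leP 0 (Num.min s 1)); case: (leP 0 (Num.min t 1));
  case: (leP s 1) => ?; case: (leP t 1) => ? ? ?; lra.
Qed.

Lemma set_val_continuous (T : topologicalType) (B : set T) :
  continuous (set_val : B -> T).
Proof. exact: initial_continuous. Qed.

Lemma clamp_continuous : continuous clamp.
Proof.
apply: continuous_comp_initial => t; apply/cvgrPdist_lt => e e0.
near=> s; apply: le_lt_trans (clamp_lipschitz _ _) _.
by near: s; move: e e0; apply/cvgrPdist_lt.
Unshelve. all: by end_near. Qed.

Lemma unitI_compact : compact [set: unitI R].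
Proof.
have -> : [set: unitI R] = clamp @` `[0, 1].
  apply/esym/seteqP; split => // t _; exists (set_val t); last exact: clampK.
  by rewrite /= in_itv /=; exact: set_valI01.
apply: continuous_compact; last exact: segment_compact.
by apply: continuous_subspaceT; exact: clamp_continuous.
Qed.

End unit_interval.

(** * The covering map *)

Section covering.
Context {R : realType}.
Implicit Types (s t : R) (z : circle R).

Lemma circle_eq z z' : (set_val z).1 = (set_val z').1 ->
  (set_val z).2 = (set_val z').2 -> z = z'.
Proof.
case: z => -[x y] h; case: z' => -[x' y'] h'; rewrite !set_valE /= => xx yy.
by apply: eq_sig_hprop => //=; rewrite xx yy.
Qed.

Lemma circleE z : (set_val z).1 ^+ 2 + (set_val z).2 ^+ 2 = 1.
Proof. by case: z => z hz; exact: set_mem hz. Qed.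

Lemma covering_map_continuous : continuous (@covering_map R).
Proof.
apply: continuous_comp_initial => t.
have c2 : (2 * pi * s @[s --> t] --> 2 * pi * t).
  by apply: cvgM; [exact: cvg_cst|exact: cvg_id].
have cc : cos (2 * pi * s) @[s --> t] --> cos (2 * pi * t).
  exact: (@continuous_comp _ _ _ (fun s => 2 * pi * s) cos _ c2
    (@continuous_cos R _)).
have cs : sin (2 * pi * s) @[s --> t] --> sin (2 * pi * t).
  exact: (@continuous_comp _ _ _ (fun s => 2 * pi * s) sin _ c2
    (@continuous_sin R _)).
exact: cvg_pair cc cs.
Qed.

Lemma covering_mapD1 t : covering_map (t + 1) = covering_map t.
Proof.
apply: circle_eq; rewrite !set_valE /= mulrDr mulr1 mulr_natl.
  by rewrite cosD2pi.
by rewrite sinD2pi.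
Qed.

Lemma covering_mapDz t (m : int) : covering_map (t + m%:~R) = covering_map t.
Proof.
have Dn s (n : nat) : covering_map (s + n%:R) = covering_map s.
  by elim: n s => [|n IH] s; rewrite ?addr0// -addn1 natrD addrA covering_mapD1.
case: m => n; first exact: Dn.
by rewrite NegzE mulrNz -[in RHS](subrK n.+1%:R t) Dn.
Qed.

(** The fractional part r of s - t satisfies cos (2 pi r) = 1, hence sin (pi r) = 0 by the
    duplication formula; since sine is positive on (0, pi), r = 0. *)
Lemma covering_map_eq s t : covering_map s = covering_map t ->
  exists m : int, s = t + m%:~R.
Proof.
move=> st; exists (Num.floor (s - t)); set m := Num.floor _.
pose r := s - t - m%:~R.
have /andP[r0 r1] : 0 <= r < 1.
  have /andP[] := floor_itv (s - t); rewrite -/m intrD /r; lra.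
suff : r = 0 by rewrite /r; lra.
have /(congr1 set_val) : covering_map (t + r) = covering_map t.
  by rewrite -(covering_mapDz _ m) -st; congr covering_map; rewrite /r; ring.
rewrite !set_valE /= => -[ce se].
have c1 : cos (2 * pi * r) = 1.
  have -> : 2 * pi * r = 2 * pi * (t + r) - 2 * pi * t by ring.
  by rewrite cosB ce se -!expr2 cos2Dsin2.
have s0 : sin (pi * r) = 0.
  move: c1; rewrite -mulrA mulr_natl cos_mulr2n.
  have := cos2Dsin2 (pi * r) => h1 h2.
  by apply/eqP; rewrite -sqrf_eq0; apply/eqP; move: h1 h2; rewrite mulr2n; lra.
apply: contra_eq s0 => rn0; rewrite gt_eqF// sin_gt0_pi//.
have r0' : 0 < r by rewrite lt_neqAle eq_sym rn0.
by rewrite mulr_gt0 ?pi_gt0//= -[ltRHS]mulr1 ltr_pM2l ?pi_gt0.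
Qed.

Lemma covering_map_inj s t : 0 <= s < 1 -> 0 <= t < 1 ->
  covering_map s = covering_map t -> s = t.
Proof.
move=> /andP[s0 s1] /andP[t0 t1] /covering_map_eq[m st].
suff : m = 0 by move=> m0; rewrite st m0 addr0.
have m1 : m < 1 by rewrite -(ltr_int R); lra.
have m2 : -1 < m by rewrite -(ltr_int R) mulrNz; lra.
lia.
Qed.

Lemma covering_map_surj z : exists2 t, 0 <= t < 1 & covering_map t = z.
Proof.
have xy := circleE z; set x := (set_val z).1 in xy; set y := (set_val z).2 in xy.
have x1 : -1 <= x <= 1 by nra.
have p0 : 0 < pi :> R by exact: pi_gt0.
have a0 := acos_ge0 x1; have api := acos_lepi x1.
have ca : cos (acos x) = x by rewrite acosK.
have sa : sin (acos x) = `|y|.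
  rewrite sin_acos//.
  have -> : 1 - x ^+ 2 = y ^+ 2 by rewrite -xy; ring.
  exact: sqrtr_sqr.
have pE (u : R) : 2 * pi * (u / (2 * pi)) = u.
  by rewrite mulrC divfK// mulf_neq0// gt_eqF.
have [y0|y0] := lerP 0 y.
  exists (acos x / (2 * pi)).
    apply/andP; split; first by apply: divr_ge0 => //; lra.
    by rewrite ltr_pdivrMr; lra.
  apply: circle_eq; rewrite set_valE /= pE; first exact: ca.
  by rewrite sa ger0_norm.
(* On the open lower half circle the angle is 1 - acos x / (2 pi); x < 1 makes the arccosine
   positive, which keeps this below 1. *)
have x1' : x < 1 by nra.
have a0' : 0 < acos x.
  rewrite lt_neqAle a0 andbT; apply/eqP => a00.
  by move: ca x1'; rewrite -a00 cos0 => <-; rewrite ltxx.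
exists (1 - acos x / (2 * pi)).
  have : acos x / (2 * pi) <= 1 by rewrite ler_pdivrMr; lra.
  have : 0 < acos x / (2 * pi) by apply: divr_gt0 => //; lra.
  lra.
rewrite addrC covering_mapD1; apply: circle_eq; rewrite set_valE /= mulrN pE.
  by rewrite cosN.
by rewrite sinN sa ltr0_norm// opprK.
Qed.

Lemma angleP z : 0 <= angle z < 1 /\ covering_map (angle z) = z.
Proof.
rewrite /angle; case: xgetP => [t _ []//|h].
by have [t t01 tz] := covering_map_surj z; case: (h t).
Qed.

(** On unit vectors, [dot] and [cross] are the cosine and sine of the oriented angle from [z] to
    [z']. *)
Definition dot z z' : R :=
  (set_val z).1 * (set_val z').1 + (set_val z).2 * (set_val z').2.
Definition cross z z' : R :=
  (set_val z).1 * (set_val z').2 - (set_val z).2 * (set_val z').1.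

(** Both coordinates differ by less than 1, so 2 - 2 dot = |z - z'|^2 < 2. *)
Lemma dot_gt0 z z' : ball z 1 z' -> 0 < dot z z'.
Proof.
move=> []; have := circleE z; have := circleE z'; rewrite /dot.
rewrite /ball /=.
set x := (set_val z).1; set y := (set_val z).2.
set x' := (set_val z').1; set y' := (set_val z').2.
move=> h h'; rewrite !ltr_norml => /andP[a b] /andP[c d]; nra.
Qed.

(** Since dot^2 + cross^2 = 1 and dot > 0, the arctangent has cosine dot and sine cross; the
    addition formulas then rotate [z] to [z']. *)
Lemma covering_map_step z z' t : 0 < dot z z' -> covering_map t = z ->
  covering_map (t + atan (cross z z' / dot z z') / (2 * pi)) = z'.
Proof.
move=> d0 tz; set d := dot z z' in d0 *; set k := cross z z'.
have hz := circleE z; have hz' := circleE z'.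
have cz : cos (2 * pi * t) = (set_val z).1 by rewrite -tz.
have sz : sin (2 * pi * t) = (set_val z).2 by rewrite -tz.
have dk : d ^+ 2 + k ^+ 2 = 1.
  rewrite -[RHS](mulr1 1) -{1}hz -hz' /d /k /dot /cross; ring.
have dn0 : d != 0 by rewrite gt_eqF.
set a := atan (k / d).
have ca : cos a = d.
  rewrite cos_atan.
  have -> : 1 + (k / d) ^+ 2 = (d^-1) ^+ 2.
    by rewrite -[RHS]mul1r -[in RHS]dk; field.
  by rewrite sqrtr_sqr gtr0_norm ?invr_gt0// invrK.
have sa : sin a = k.
  have := atanK (k / d); rewrite -/a /tan ca => /(congr1 ( *%R^~ d)).
  by rewrite !divfK.
have -> : t + a / (2 * pi) = (2 * pi * t + a) / (2 * pi).
  by rewrite [RHS]mulrDl [_ * t / _]mulrAC mulfV ?mul1r//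
    mulf_neq0// gt_eqF// pi_gt0.
apply: circle_eq; rewrite set_valE /= mulrC divfK ?mulf_neq0 ?gt_eqF ?pi_gt0//.
  rewrite cosD cz sz ca sa /d /k /dot /cross -[RHS]mul1r -hz; ring.
rewrite sinD cz sz ca sa /d /k /dot /cross -[RHS]mul1r -hz; ring.
Qed.

End covering.

(** * Path lifting and maps of the circle *)

Section path_lifting.
Context {R : realType}.

Lemma path_step_continuous (c c' : unitI R -> circle R) :
  continuous c -> continuous c' -> (forall t, 0 < dot (c t) (c' t)) ->
  continuous (fun t => atan (cross (c t) (c' t) / dot (c t) (c' t)) / (2 * pi)).
Proof.
move=> cc cc' d0 t.
have coord1 (b : unitI R -> circle R) : continuous b ->
    (set_val (b s)).1 @[s --> t] --> (set_val (b t)).1.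
  move=> cb; apply: (@continuous_comp _ _ _ (set_val \o b) fst).
    by apply: continuous_comp; [exact: cb|exact: set_val_continuous].
  exact: cvg_fst.
have coord2 (b : unitI R -> circle R) : continuous b ->
    (set_val (b s)).2 @[s --> t] --> (set_val (b t)).2.
  move=> cb; apply: (@continuous_comp _ _ _ (set_val \o b) snd).
    by apply: continuous_comp; [exact: cb|exact: set_val_continuous].
  exact: cvg_snd.
have cdot : dot (c s) (c' s) @[s --> t] --> dot (c t) (c' t).
  exact: cvgD (cvgM (coord1 _ cc) (coord1 _ cc'))
    (cvgM (coord2 _ cc) (coord2 _ cc')).
have ccross : cross (c s) (c' s) @[s --> t] --> cross (c t) (c' t).
  exact: cvgB (cvgM (coord1 _ cc) (coord2 _ cc'))
    (cvgM (coord2 _ cc) (coord1 _ cc')).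
have dn0 : dot (c t) (c' t) != 0 by rewrite gt_eqF.
have cq : cross (c s) (c' s) / dot (c s) (c' s) @[s --> t] -->
    cross (c t) (c' t) / dot (c t) (c' t).
  exact: (cvgM ccross (cvgV dn0 cdot)).
have catan : atan (cross (c s) (c' s) / dot (c s) (c' s)) @[s --> t] -->
    atan (cross (c t) (c' t) / dot (c t) (c' t)).
  exact: (continuous_comp cq (@continuous_atan R _)).
exact: (cvgMr_tmp catan).
Qed.

(* The lift is [angle (c 0)] plus the sum of the signed angles between the
   consecutive points [c (k t / n)] and [c ((k + 1) t / n)], which uniform
   continuity keeps in the range of the arctangent. *)
Lemma path_lift (c : unitI R -> circle R) : continuous c ->
  exists h : unitI R -> R, [/\ continuous h,
    forall t, covering_map (h t) = c t & 0 <= h (I0 R) < 1].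
Proof.
move=> cc.
have [d d0 cd] := compact_uniformly_continuous unitI_compact cc
  (ltr01 : 0 < 1 :> R).
(* This makes the time step 1 / n smaller than the modulus [d]; the successor keeps [n] positive. *)
pose n := (Num.bound d^-1).+1.
have n0 : 0 < n%:R :> R by [].
have nd : n%:R^-1 < d.
  rewrite -[ltRHS]invrK ltf_pV2 ?posrE ?invr_gt0//.
  apply: lt_trans (archi_boundP _) _; first by rewrite invr_ge0 ltW.
  by rewrite ltr_nat.
pose s (k : nat) (t : unitI R) : unitI R := clamp (k%:R / n%:R * set_val t).
have sc k : continuous (s k).
  move=> t.
  have cv : set_val u @[u --> t] --> (set_val t : R) by exact: set_val_continuous.
  have ckn : k%:R / n%:R * set_val u @[u --> t] -->
      k%:R / n%:R * (set_val t : R).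
    exact: (cvgMl_tmp cv).
  exact: (continuous_comp ckn (@clamp_continuous R _)).
have sd k t : ball (s k t) d (s k.+1 t).
  apply: le_lt_trans (clamp_lipschitz _ _) _; apply: le_lt_trans nd.
  have -> : k%:R / n%:R * set_val t - k.+1%:R / n%:R * set_val t =
      - (n%:R^-1 * set_val t).
    by rewrite -addn1 natrD; field; rewrite gt_eqF.
  have /andP[t0 t1] := set_valI01 t.
  rewrite normrN ger0_norm ?mulr_ge0 ?invr_ge0//.
  by rewrite -[leRHS]mulr1 ler_pM2l ?invr_gt0.
have s0 k : s k (I0 R) = I0 R by rewrite /s set_valE /= mulr0 clamp0.
have csc k : continuous (c \o s k).
  by move=> t; apply: continuous_comp; [exact: sc|exact: cc].
(* Induction on [k] lifts the path slowed down to speed k / n; at k = n this is [c] itself. *)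
suff /(_ n)[h [ch hc h01]] : forall k, exists h : unitI R -> R,
    [/\ continuous h, forall t, covering_map (h t) = c (s k t)
      & 0 <= h (I0 R) < 1].
  exists h; split => // t.
  by rewrite hc /s divff ?mul1r ?clampK// gt_eqF.
elim=> [|k [h [ch hc h01]]].
  have [a01 ac] := angleP (c (I0 R)).
  exists (fun=> angle (c (I0 R))); split => //; first exact: cst_continuous.
  by move=> t; rewrite ac /s !mul0r clamp0.
have dk t : 0 < dot (c (s k t)) (c (s k.+1 t)) by apply: dot_gt0; exact/cd/sd.
exists (fun t => h t + atan (cross (c (s k t)) (c (s k.+1 t)) /
   dot (c (s k t)) (c (s k.+1 t))) / (2 * pi)); split.
- move=> t.
  have step := @path_step_continuous (c \o s k) (c \o s k.+1)
    (csc k) (csc k.+1) dk t.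
  exact: (cvgD (ch t) step).
- by move=> t; exact: covering_map_step.
(* At time 0 all the points coincide, so the added angle is 0 and the initial value is unchanged. *)
- by rewrite !s0 /cross [X in X - _]mulrC subrr mul0r atan0 mul0r addr0.
Qed.

(* The two lifts differ by an integer, so their distance cannot take the
   value 1/2 on its way from 0. *)
Lemma path_lift_unique (h k : unitI R -> R) :
  continuous h -> continuous k ->
  (forall t, covering_map (h t) = covering_map (k t)) ->
  0 <= h (I0 R) < 1 -> 0 <= k (I0 R) < 1 -> h = k.
Proof.
move=> ch ck hk h01 k01; apply/funext => t.
have hk0 : h (I0 R) = k (I0 R) by exact: covering_map_inj.
(* Composing with [clamp] gives a function on the line, to which the intermediate value theorem
   applies. *)
pose d (x : R) := `|h (clamp x) - k (clamp x)|.
have dint x : exists n : nat, d x = n%:R.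
  have [m hm] := covering_map_eq (hk (clamp x)).
  by exists `|m|%N; rewrite /d hm addrAC subrr add0r -intr_norm natr_absz.
have cd : continuous d.
  move=> x; apply: cvg_norm; apply: cvgB.
    by apply: (@continuous_comp _ _ _ clamp h); [exact: clamp_continuous|exact: ch].
  by apply: (@continuous_comp _ _ _ clamp k); [exact: clamp_continuous|exact: ck].
have d0 : d 0 = 0 by rewrite /d clamp0 hk0 subrr normr0.
have [n dn] := dint (set_val t).
have [n0|n0] := posnP n.
  by move: dn; rewrite n0 /d clampK => /normr0_eq0/eqP; rewrite subr_eq0 => /eqP.
have /andP[t0 t1] := set_valI01 t.
have [|x _ dx] := @IVT R d 0 (set_val t) (2^-1) t0 (continuous_subspaceT cd).
  rewrite d0 dn min_l// max_r// invr_ge0 ler0n/=.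
  have : (1 : R) <= n%:R by rewrite ler1n.
  lra.
have [m dm] := dint x.
have : (2 * m)%:R = 1%:R :> R by rewrite natrM -dm dx mulfV.
by move/eqP; rewrite eqr_nat; lia.
Qed.

(** * Lifts of circle maps, and the circle as a quotient of the interval *)

Lemma alpha_continuous : continuous (@alpha R).
Proof.
move=> t; apply: continuous_comp; first exact: set_val_continuous.
exact: covering_map_continuous.
Qed.

(** Existence of path lifts rules out the default value in the definition of [lift_alpha]. *)
Lemma lift_alphaP (f : continuousType (circle R) (circle R)) :
  [/\ continuous (lift_alpha f),
      forall t, covering_map (lift_alpha f t) = f (alpha t)
    & 0 <= lift_alpha f (I0 R) < 1].
Proof.
rewrite /lift_alpha; case: xgetP => [h _ //|none].
have [|h hP] := @path_lift (f \o @alpha R); last by case: (none h).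
move=> t; apply: continuous_comp; last exact: cts_fun.
exact: alpha_continuous.
Qed.

Lemma alpha_surj (z : circle R) : exists t, alpha t = z.
Proof.
have [t /andP[t0 t1] tz] := covering_map_surj z.
exists (clamp t); rewrite -tz /alpha; congr covering_map.
by rewrite set_valE /= (min_l (ltW t1)) (max_r t0).
Qed.

Lemma alpha_I0 : alpha (I0 R) = base_pt R.
Proof.
by apply: circle_eq; rewrite !set_valE /= set_valE /= mulr0 ?cos0 ?sin0.
Qed.

(* [alpha] is a continuous surjection from a compact space to a Hausdorff one,
   hence a closed map. *)
Lemma alpha_quotient (T : topologicalType) (g : circle R -> T) :
  continuous (g \o @alpha R) -> continuous g.
Proof.
move=> /continuous_closedP cga; apply/continuous_closedP => C /cga clK.
set K := _ @^-1` C in clK.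
(* The image of [K] is shown closed in the plane, as a compact set there, and then pulled back to
   the circle. *)
have : closed (set_val @` (@alpha R @` K)).
  apply: compact_closed; first exact: norm_hausdorff.
  apply: continuous_compact; first exact/continuous_subspaceT/set_val_continuous.
  apply: continuous_compact; first exact/continuous_subspaceT/alpha_continuous.
  by rewrite -[K]setTI; apply: compact_closedI => //; exact: unitI_compact.
have /continuous_closedP := @set_val_continuous _ (circle R).
move=> /[apply]; congr closed; apply/seteqP; split => z /=.
  by move=> [_ [t Kt <-]] /val_inj <-.
have [t <-] := alpha_surj z => gC.
by exists (alpha t) => //; exists t.
Qed.

(** The integer s - t lies in {-1, 0, 1}, and the values 1 and -1 force opposite endpoints. *)
Lemma alpha_eq (s t : unitI R) : alpha s = alpha t ->
  [\/ s = t, s = I0 R /\ t = I1 R | s = I1 R /\ t = I0 R].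
Proof.
move=> /covering_map_eq[m]; have /andP[s0 s1] := set_valI01 s.
have /andP[t0 t1] := set_valI01 t => st.
have m2 : m < 2 by rewrite -(ltr_int R); lra.
have m3 : -2 < m by rewrite -(ltr_int R) mulrNz; lra.
have [m0|[m1|mN1]] : m = 0 \/ m = 1 \/ m = -1 by lia.
- by constructor 1; rewrite -(clampK s) -(clampK t) st m0 addr0.
- constructor 3; rewrite -clamp0 -clamp1 -(clampK s) -(clampK t).
  by split; congr clamp; move: st; rewrite m1; lra.
- constructor 2; rewrite -clamp0 -clamp1 -(clampK s) -(clampK t).
  by split; congr clamp; move: st; rewrite mN1 mulrNz; lra.
Qed.

Lemma circle_map_of_lift (h : unitI R -> R) (m : int) :
  continuous h -> 0 <= h (I0 R) < 1 -> h (I1 R) = h (I0 R) + m%:~R ->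
  exists g : continuousType (circle R) (circle R), lift_alpha g = h.
Proof.
move=> ch h01 hm.
(* The chosen preimage is immaterial: [alpha] identifies only the endpoints, where the values of [h]
   differ by an integer. *)
pose g0 (z : circle R) := covering_map (h (xget (I0 R) [set t | alpha t = z])).
have h1 : covering_map (h (I1 R)) = covering_map (h (I0 R)).
  by rewrite hm covering_mapDz.
have g0E t : g0 (alpha t) = covering_map (h t).
  rewrite /g0; case: xgetP => [s _ /= /alpha_eq|none]; last by case: (none t).
  by case=> [->|[-> ->]|[-> ->]].
have cg0 : continuous g0.
  apply: alpha_quotient.
  have -> : g0 \o @alpha R = @covering_map R \o h by apply/funext => u; exact: g0E.
  by move=> u; apply: continuous_comp; [exact: ch|exact: covering_map_continuous].
pose gm := isContinuous.Build _ _ g0 cg0.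
pose g : continuousType (circle R) (circle R) := HB.pack g0 gm.
exists g; have [cl lg l01] := lift_alphaP g.
by apply: path_lift_unique => // t; rewrite lg -g0E.
Qed.

End path_lifting.

(** * Density of the circle maps whose lift lies in the algebra *)

Theorem theorem4p3 (R : realType) (A : set (unitI R -> R))
    (hA : unital_subalgebra A) (hsep : separates_points A)
    (m : int) (q : circle R) :
  dense_in (@d0 R) (P_mq A m q) (C_mq m q).
Proof.
split=> [f [[_ l0 l1] lq]|f [fq wf] e e0].
  have [_ lf _] := lift_alphaP f; split.
    by rewrite -alpha_I0 -lf.
  by rewrite /winding l0 l1 addrAC subrr add0r.
have [cl lf l01] := lift_alphaP f.
have [q01 qq] := angleP q.
have l0 : lift_alpha f (I0 R) = angle q.
  by apply: covering_map_inj => //; rewrite qq lf alpha_I0.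
have l1 : lift_alpha f (I1 R) = angle q + m%:~R.
  by move: wf; rewrite /winding l0; lra.
case: hA => A1 A2 A3 A4 A5.
have I01 : I0 R <> I1 R by move/(congr1 set_val); rewrite !set_valE /=; lra.
have p0 : 0 < 2 * pi :> R by rewrite mulr_gt0// pi_gt0.
(* The factor 2 pi of [d0] is divided out; the extra half restores strictness, as a supremum of
   values below a bound may reach it. *)
have e4 : 0 < e / (2 * pi) / 2 by rewrite !divr_gt0.
have [h Ah [h0 h1 fh]] := stone_weierstrass_endpoints unitI_compact A1 A2 A3 A4 A5
  hsep cl I01 e4.
have [||g lg] := @circle_map_of_lift _ h m (A1 _ Ah).
- by rewrite h0 l0.
- by rewrite h1 h0 l1 l0.
exists g; first by split; rewrite lg ?h0 ?l0//; split; rewrite ?h0 ?h1.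
rewrite /d0 lg.
apply: (@le_lt_trans _ _ (2 * pi * (e / (2 * pi) / 2))); last first.
  rewrite mulrA mulrCA mulfV ?gt_eqF// mulr1; lra.
rewrite ler_pM2l//; set S := (X in sup X).
(* [ge_sup] requires a nonempty set; the supremum of the empty set is 0 by convention. *)
have [->|/set0P S0] := eqVneq S set0; first by rewrite sup0 ltW.
by apply: ge_sup => // _ [x _ <-]; exact/ltW/fh.
Qed.
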